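(* Let $\Omega=\Delta(A,B,C)$ be a non-degenerate triangle and let $N\ge 1$ be an integer. Let $\mathcal{P}=(\boldsymbol{x}_1,\dots,\boldsymbol{x}_N)$, where $\boldsymbol{x}_i=f_\Omega(i-1)$ for $i=1,\dots,N$ are the first $N$ triangular van der Corput points of $\Omega$. Then $$D_N^{\mathrm{P}}(\mathcal{P};\Omega)\le \frac{12}{\sqrt N}.$$
   Context: Triangles. For non-collinear points $A,B,C\in\mathbb{R}^d$, $\Delta(A,B,C)=\{\omega_1A+\omega_2B+\omega_3C : \omega_j\ge 0,\ \omega_1+\omega_2+\omega_3=1\}$ is a non-degenerate (closed) triangle. $\mathbf{vol}$ denotes two-dimensional Lebesgue measure in the plane containing the triangle. Parallelogram discrepancy. Let $\Omega=\Delta(A,B,C)$. For $a,b\in(0,1]$ let $\mathcal{T}_{a,b,C}=\{C+s(A-C)+t(B-C): 0\le s\le a,\ 0\le t\le b\}$ be the parallelogram with vertex $C$ and side vectors $a(A-C)$, $b(B-C)$. Let $\mathcal{S}_C=\{\mathcal{T}_{a,b,C}: 0<a\le 1,\ 0<b\le 1\}$, define $\mathcal{S}_A,\mathcal{S}_B$ analogously (vertex $A$, resp. $B$, with side vectors along the two triangle sides leaving that vertex), and $\mathcal{S}_{\mathrm{P}}=\mathcal{S}_A\cup\mathcal{S}_B\cup\mathcal{S}_C$. For a list $\mathcal{P}=(\boldsymbol{x}_1,\dots,\boldsymbol{x}_N)$ of points of $\Omega$ and a measurable set $S$, put $\delta_N(S;\mathcal{P},\Omega)=\mathbf{vol}(S\cap\Omega)/\mathbf{vol}(\Omega)-\frac1N\sum_{i=1}^N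 1_{\boldsymbol{x}_i\in S}$. Then $D_N^{\mathrm{P}}(\mathcal{P};\Omega)=\sup_{S\in\mathcal{S}_{\mathrm{P}}}|\delta_N(S;\mathcal{P},\Omega)|$. Triangular van der Corput points. For a triangle $T=\Delta(A,B,C)$ with ordered vertices and a digit $d\in\{0,1,2,3\}$ define the subtriangle $T(d)$ (with ordered vertices) by $T(0)=\Delta(\frac{B+C}2,\frac{A+C}2,\frac{A+B}2)$, $T(1)=\Delta(A,\frac{A+B}2,\frac{A+C}2)$, $T(2)=\Delta(\frac{B+A}2,B,\frac{B+C}2)$, $T(3)=\Delta(\frac{C+A}2,\frac{C+B}2,C)$. Recursively, $T(d_1,\dots,d_K)=(T(d_1,\dots,d_{K-1}))(d_K)$. For an integer $i\ge1$ write $i=\sum_{k=1}^{K}d_k4^{k-1}$ with $d_k\in\{0,1,2,3\}$; then $f_T(i)$ is the centroid (arithmetic mean of the vertices) of $T(d_1,\dots,d_K)$. This does not depend on how many leading zero digits are included, since $T'$ and $T'(0)$ have the same centroid. Also $f_T(0)$ is the centroid of $T$. *)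

(* Defs.v *)
From HB Require Import structures.
From mathcomp Require Import all_boot all_order all_algebra.
From mathcomp Require Import all_classical all_reals all_analysis.

Set Implicit Arguments.
Unset Strict Implicit.
Unset Printing Implicit Defensive.

Import Order.TTheory GRing.Theory Num.Theory.
Import numFieldNormedType.Exports.

Local Open Scope classical_set_scope.
Local Open Scope ring_scope.

Section Triangles.
Context {R : realType} {d : nat}.
Local Notation point := 'rV[R]_d.

Definition collinear (A B C : point) : Prop :=
  exists P v : point, exists a b c : R,
    [/\ A = P + a *: v, B = P + b *: v & C = P + c *: v].

(* A triangle with ordered vertices; non-degeneracy is not built in. *)
Record triangle := Triangle { vA : point; vB : point; vC : point }.

Definition tri_set (T : triangle) : set point :=
  [set x | exists w1 w2 w3 : R,
     [/\ 0 <= w1, 0 <= w2, 0 <= w3, w1 + w2 + w3 = 1 &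
         x = w1 *: vA T + w2 *: vB T + w3 *: vC T]].

Definition centroid (T : triangle) : point :=
  3%:R^-1 *: (vA T + vB T + vC T).

(* The norm `|u| of the library on 'rV[R]_d is the sup norm, hence an explicit
   Euclidean structure. *)
Definition dot (u v : point) : R := \sum_(i < d) u 0 i * v 0 i.

Definition unit_vec (u : point) : point := (Num.sqrt (dot u u))^-1 *: u.

(* Gram-Schmidt on B - A, C - A: for a non-degenerate triangle, (axis1, axis2)
   is an orthonormal basis of the direction of the plane of the triangle. *)
Definition axis1 (T : triangle) : point := unit_vec (vB T - vA T).

Definition axis2 (T : triangle) : point :=
  unit_vec ((vC T - vA T) - dot (vC T - vA T) (axis1 T) *: axis1 T).

(* Two-dimensional Lebesgue measure on the plane of T, transported from R * R
   by the isometry (p1, p2) |-> A + p1 axis1 + p2 axis2. *)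
Definition vol (T : triangle) (S : set point) : \bar R :=
  (@lebesgue_measure R \x @lebesgue_measure R)%E
    [set p : R * R | S (vA T + p.1 *: axis1 T + p.2 *: axis2 T)].

Definition parallelogram (P Q Q' : point) (a b : R) : set point :=
  [set x | exists s t : R,
     [/\ 0 <= s <= a, 0 <= t <= b & x = P + s *: (Q - P) + t *: (Q' - P)]].

Definition corner_parallelograms (P Q Q' : point) : set (set point) :=
  [set parallelogram P Q Q' a b | a in `]0, 1] & b in `]0, 1]].

Definition parallelograms (T : triangle) : set (set point) :=
  corner_parallelograms (vA T) (vB T) (vC T) `|`
  corner_parallelograms (vB T) (vA T) (vC T) `|`
  corner_parallelograms (vC T) (vA T) (vB T).

Definition delta (S : set point) (X : seq point) (T : triangle) : R :=
  fine (vol T (S `&` tri_set T)) / fine (vol T (tri_set T))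
  - (\sum_(x <- X) \1_S x) / (size X)%:R.

Definition par_discrepancy (X : seq point) (T : triangle) : \bar R :=
  ereal_sup [set (`|delta S X T|)%:E | S in parallelograms T].

Definition midpoint (P Q : point) : point := 2%:R^-1 *: (P + Q).

Definition subtri (T : triangle) (k : 'I_4) : triangle :=
  let: Triangle A B C := T in
  match val k with
  | 0 => Triangle (midpoint B C) (midpoint A C) (midpoint A B)
  | 1 => Triangle A (midpoint A B) (midpoint A C)
  | 2 => Triangle (midpoint B A) B (midpoint B C)
  | _ => Triangle (midpoint C A) (midpoint C B) C
  end.

Definition subtri_seq (T : triangle) (ks : seq 'I_4) : triangle :=
  foldl subtri T ks.

(* Base-4 digits of i, least significant first ([::] for i = 0); inZp reduces
   modulo 4. *)
Definition digits4 (i : nat) : seq 'I_4 :=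
  if i == 0%N then [::]
  else mkseq (fun k => inZp (i %/ 4 ^ k)%N) (trunc_log 4 i).+1.

Definition vdc (T : triangle) (i : nat) : point :=
  centroid (subtri_seq T (digits4 i)).

End Triangles.
Arguments triangle : clear implicits.

Definition value4 (ks : seq 'I_4) : nat :=
  (\sum_(k < size ks) nth ord0 ks k * 4 ^ k)%N.

Lemma digits4K : cancel digits4 value4.
Proof.
move=> i; rewrite /digits4 /value4; have [->|i_neq0] := eqVneq i 0%N.
  by rewrite /= big_ord0.
rewrite size_mkseq.
have partial n :
    (\sum_(k < n) (i %/ 4 ^ k %% 4) * 4 ^ k + i %/ 4 ^ n * 4 ^ n = i)%N.
  elim: n => [|n IHn]; first by rewrite big_ord0 expn0 divn1 muln1.
  rewrite big_ord_recr /= -[RHS]IHn -addnA; congr addn.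
  rewrite expnSr divnMA [X in (_ = X * _)%N](divn_eq _ 4) mulnDl addnC.
  by rewrite [(4 ^ n * 4)%N]mulnC mulnA.
rewrite -[RHS](partial (trunc_log 4 i).+1) [X in (X * _)%N]divn_small.
  by rewrite mul0n addn0; apply: eq_bigr => k _; rewrite nth_mkseq.
exact: trunc_log_ltn.
Qed.

Section Frame.
Context {R : realType} {d : nat}.
Implicit Types u v : 'rV[R]_d.

Lemma dotC u v : dot u v = dot v u.
Proof. by apply: eq_bigr => i _; rewrite mulrC. Qed.

Lemma dotZl a u v : dot (a *: u) v = a * dot u v.
Proof. by rewrite /dot mulr_sumr; apply: eq_bigr => i _; rewrite mxE mulrA. Qed.

Lemma dotBl u u' v : dot (u - u') v = dot u v - dot u' v.
Proof.
by rewrite /dot -sumrB; apply: eq_bigr => i _; rewrite !mxE mulrBl.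
Qed.

Lemma dot_gt0 u : u != 0 -> 0 < dot u u.
Proof.
have dot_ge0 : 0 <= dot u u by apply: sumr_ge0 => i _; rewrite -expr2 sqr_ge0.
rewrite lt_def dot_ge0 andbT; apply: contraNneq => /eqP.
rewrite psumr_eq0 => [/allP u0|i _]; last by rewrite -expr2 sqr_ge0.
apply/eqP/rowP => i; rewrite mxE; have := u0 i (mem_index_enum i).
by rewrite /= mulf_eq0 orbb => /eqP.
Qed.

Lemma dot_unit_vec u : u != 0 -> dot (unit_vec u) (unit_vec u) = 1.
Proof.
move=> /dot_gt0 u_gt0; rewrite /unit_vec dotZl dotC dotZl mulrA -expr2 exprVn.
by rewrite sqr_sqrtr ?ltW// mulVf// gt_eqF.
Qed.

Lemma axis_orthonormal (A B C : 'rV[R]_d) (T := Triangle A B C) :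
  ~ collinear A B C ->
  [/\ dot (axis1 T) (axis1 T) = 1, dot (axis2 T) (axis2 T) = 1 &
      dot (axis1 T) (axis2 T) = 0].
Proof.
move=> nABC.
have AB : B - A != 0.
  apply: contra_notN nABC => /eqP/subr0_eq ->.
  by exists A, (C - A), 0, 0, 1; rewrite scale0r addr0 scale1r subrKC.
have a11 : dot (axis1 T) (axis1 T) = 1 by exact: dot_unit_vec.
split=> //; last first.
  by rewrite dotC dotZl [X in _ * X]dotBl dotZl a11 mulr1 subrr mulr0.
apply: dot_unit_vec; apply: contra_notN nABC => /eqP/subr0_eq /= CA.
exists A, (B - A), 0, 1, (dot (C - A) (axis1 T) / Num.sqrt (dot (B - A) (B - A))).
by rewrite scale0r addr0 scale1r subrKC -scalerA -CA subrKC.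
Qed.

End Frame.

(* Main.v *)
(* In barycentric coordinates each parallelogram meets the triangle in
   [{w_i <= a, w_j <= b}], whose share of the area is
   [1 - (1 - a)^2 - (1 - b)^2 + ((1 - a - b)^+)^2]. Passing to a subtriangle
   acts on coordinates by [w |-> (w + [0 or 1]) / 2] or, for the central one, by
   [w |-> (1 - w) / 2]. Hence, in a block of [4^k] consecutive indices starting
   at a multiple of [4^k], the number of points with [2^k w_i < p] and
   [2^k w_j < q] satisfies a recursion solved by the same area formula, exactly.
   Monotonicity in [a], [b] turns this into a discrepancy of at most [2 * 2^k]
   per block, and the at most three blocks for each base-4 digit of [N] give
   [6 * (2^(K + 1) - 1) <= 12 * sqrt N] in total, if [4^K <= N < 4^(K + 1)]. *)

Require Import Defs.
From HB Require Import structures.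
From mathcomp Require Import all_boot all_order all_algebra.
From mathcomp Require Import all_classical all_reals all_analysis.
From mathcomp Require Import measurable_realfun zify ring lra.

Import Order.TTheory GRing.Theory Num.Theory.
Import numFieldNormedType.Exports.

Local Open Scope ring_scope.

(** * Integer arithmetic of the counting recursion *)

Definition trunc_sq (x y : nat) : int := (x - y)%N%:Z ^+ 2.

Lemma trunc_sqE {x y : nat} : (y <= x)%N -> trunc_sq x y = (x%:Z - y%:Z) ^+ 2.
Proof. by move=> yx; rewrite /trunc_sq subzn. Qed.

Lemma trunc_sq_eq0 {x y : nat} : (x <= y)%N -> trunc_sq x y = 0.
Proof. by rewrite /trunc_sq => /eqP ->. Qed.

Lemma trunc_sqC x y : trunc_sq x y = (x%:Z - y%:Z) ^+ 2 - trunc_sq y x.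
Proof.
have [xy|/ltnW yx] := leqP x y.
  by rewrite trunc_sq_eq0// trunc_sqE//; ring.
by rewrite trunc_sqE// trunc_sq_eq0//; ring.
Qed.

(* The step [k -> k + 1] of [count_bary], where [m = 2 ^ k], [h p q] counts the
   points below [p] and [q] at level [k], and [s] is the contribution of the
   central subtriangle, which reverses both inequalities. *)
Lemma count_refinement (h : nat -> nat -> int) (m p q : nat) (s : int) :
  (forall x y, h x y =
    m%:Z ^+ 2 - trunc_sq m x - trunc_sq m y + trunc_sq m (x + y)) ->
  s + h (m - p)%N m + h m (m - q)%N = m%:Z ^+ 2 + h (m - p)%N (m - q)%N ->
  s + h (p - m)%N q + h p (q - m)%N + h p q =
    (2 * m)%N%:Z ^+ 2 - trunc_sq (2 * m) p - trunc_sq (2 * m) q +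
    trunc_sq (2 * m) (p + q).
Proof.
move=> hE sE.
(* Inclusion-exclusion over the points below [m - p] or [m - q]; at level [m] the threshold [m]
   itself excludes nothing. *)
have {s sE} -> :
    s = m%:Z ^+ 2 - h (m - p)%N m - h m (m - q)%N + h (m - p)%N (m - q)%N.
  by move: sE; lra.
rewrite !hE.
have cast : (2 * m)%N%:Z = 2 * m%:Z by lia.
have T0 : trunc_sq m m = 0 by rewrite trunc_sq_eq0.
have T1 x : trunc_sq m (x + m) = 0 by rewrite trunc_sq_eq0// leq_addl.
have T2 x : trunc_sq m (m + x) = 0 by rewrite trunc_sq_eq0// leq_addr.
(* A threshold reduced by [m] at level [m] is the original threshold at level [2 * m], truncation
   included. *)
have T3 x y : (m <= x)%N -> trunc_sq m (x - m + y) = trunc_sq (2 * m) (x + y).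
  by move=> mx; rewrite /trunc_sq; congr (Posz _ ^+ 2); lia.
have T4 x : (m <= x)%N -> trunc_sq m (x - m) = trunc_sq (2 * m) x.
  by move=> mx; rewrite -[(x - m)%N]addn0 T3// addn0.
rewrite !T1 !T2 T0.
have [pm|/ltnW mp] := leqP p m; have [qm|/ltnW mq] := leqP q m.
- rewrite (eqP pm) (eqP qm) addn0 add0n.
  have -> : trunc_sq m (m - p + (m - q)) =
      (p%:Z + q%:Z - m%:Z) ^+ 2 - trunc_sq m (p + q).
    have -> : trunc_sq m (m - p + (m - q)) = trunc_sq (p + q) m.
      by rewrite /trunc_sq; congr (Posz _ ^+ 2); lia.
    by rewrite trunc_sqC PoszD.
  have -> : trunc_sq m 0 = m%:Z ^+ 2 by rewrite trunc_sqE// subr0.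
  have [p2 q2 pq2] : [/\ p <= 2 * m, q <= 2 * m & p + q <= 2 * m]%N by split; lia.
  rewrite !(trunc_sqE p2) !(trunc_sqE q2) !(trunc_sqE pq2) cast.
  rewrite !(trunc_sqE (leq_subr _ _)) -!subzn// PoszD (trunc_sqE pm).
  by rewrite (trunc_sqE qm); ring.
- rewrite (eqP pm) (eqP mq) add0n addn0.
  rewrite (addnC p (q - m)%N) !T3// T4// (addnC q p).
  have -> : trunc_sq m 0 = m%:Z ^+ 2 by rewrite trunc_sqE// subr0.
  rewrite !(trunc_sq_eq0 mq) (trunc_sq_eq0 (leq_trans mq (leq_addl p q))).
  have p2 : (p <= 2 * m)%N by lia.
  rewrite (trunc_sqE p2) (trunc_sqE pm) cast.
  by rewrite !(trunc_sqE (leq_subr _ _)) -!subzn//; ring.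
- rewrite (eqP qm) (eqP mp) add0n addn0.
  rewrite !T3// T4//.
  have -> : trunc_sq m 0 = m%:Z ^+ 2 by rewrite trunc_sqE// subr0.
  rewrite !(trunc_sq_eq0 mp) (trunc_sq_eq0 (leq_trans mp (leq_addr q p))).
  have q2 : (q <= 2 * m)%N by lia.
  rewrite (trunc_sqE q2) (trunc_sqE qm) cast.
  by rewrite !(trunc_sqE (leq_subr _ _)) -!subzn//; ring.
- rewrite (eqP mp) (eqP mq) addn0 (addnC p (q - m)%N) !T3// !T4// (addnC q p).
  have -> : trunc_sq m 0 = m%:Z ^+ 2 by rewrite trunc_sqE// subr0.
  have mpq : (2 * m <= p + q)%N by lia.
  rewrite (trunc_sq_eq0 mp) (trunc_sq_eq0 mq) (trunc_sq_eq0 mpq).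
  by rewrite (trunc_sq_eq0 (leq_trans mp (leq_addr q p))) cast; ring.
Qed.

(** * Barycentric coordinates along base-4 digits *)

Lemma digits4_rec (i : nat) (k : 'I_4) : (0 < 4 * i + k)%N ->
  digits4 (4 * i + k) = k :: digits4 i.
Proof.
move=> ik_gt0.
have k4 : (k < 4)%N by [].
have headE : inZp ((4 * i + k) %/ 4 ^ 0) = k :> 'I_4.
  by apply: val_inj => /=; rewrite expn0 divn1 [(4 * i)%N]mulnC modnMDl modn_small.
have tailE j : ((4 * i + k) %/ 4 ^ j.+1 = i %/ 4 ^ j)%N.
  by rewrite expnS divnMA [(4 * i)%N]mulnC divnMDl// (divn_small k4) addn0.
rewrite /digits4 -[in LHS](prednK ik_gt0) /= prednK//.
case: eqVneq => [i0|i_neq0].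
  have -> : trunc_log 4 (4 * i + k) = 0%N.
    apply/eqP; rewrite -leqn0 -ltnS.
    rewrite -(@ltn_exp2l 4)// (leq_ltn_trans (trunc_logP _ ik_gt0))//.
    by rewrite i0 muln0 add0n expn1.
  by rewrite /mkseq /= headE.
have i_gt0 : (0 < i)%N by rewrite lt0n.
have -> : trunc_log 4 (4 * i + k) = (trunc_log 4 i).+1.
  apply: trunc_log_eq => //; apply/andP; split.
    by rewrite expnS (leq_trans _ (leq_addr _ _))// leq_mul2l/= trunc_logP.
  have := @trunc_log_ltn 4 i isT; rewrite !expnS.
  by move: (expn _ _) => e; lia.
rewrite /mkseq /= headE; congr (_ :: _ :: _).
  by apply: val_inj; rewrite /= (tailE 0%N) expn0 divn1.
rewrite -[1%N]/(0 + 1)%N -[2%N]/(1 + 1)%N.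
rewrite (iotaDl 1) -map_comp; apply: eq_map => j /=.
by rewrite tailE.
Qed.

Section Barycentric.
Context {R : realType}.
Implicit Types (c k : 'I_4) (w x : R).

(* The effect on the [c]-th barycentric coordinate of the similarity mapping
   the triangle to its [k]-th subtriangle; the vertices A, B, C are numbered
   1, 2, 3, as the corner subtriangles are. *)
Definition bary_step c k w : R :=
  if k == ord0 then (1 - w) / 2 else (w + (k == c)%:R) / 2.

(** A right fold, whereas [subtri_seq] is a left fold: the first digit picks the largest
    subtriangle, so its similarity acts last, on coordinates relative to that subtriangle. The seed
    is the coordinate of the centroid. *)
Definition bary_word c (ks : seq 'I_4) : R := foldr (bary_step c) 3^-1 ks.

Definition bary c (i : nat) : R := bary_word c (digits4 i).

Lemma bary_rec c (i : nat) k : bary c (4 * i + k) = bary_step c k (bary c i).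
Proof.
have [ik_gt0|] := ltnP 0 (4 * i + k); first by rewrite /bary digits4_rec.
(* The digit list of 0 is empty; the recursion still holds because [1 / 3] is a fixed point of the
   central step. *)
rewrite leqn0 addn_eq0 muln_eq0 /= => /andP[/eqP -> /eqP k0].
rewrite k0 /bary /= /bary_step -val_eqE /= k0 eqxx; lra.
Qed.

(** Distinctness from [ord0] makes [c1], [c2], [c3] the three vertices in some order, so a corner
    step adds 1 to exactly one coordinate before halving. *)
Lemma sum_bary_word (c1 c2 c3 : 'I_4) (ks : seq 'I_4) :
  uniq [:: ord0; c1; c2; c3] ->
  bary_word c1 ks + bary_word c2 ks + bary_word c3 ks = 1.
Proof.
move=> c_uniq; elim: ks => [|k ks] /=; first lra.
rewrite /bary_step; have: (k != ord0) -> ((k == c1) + (k == c2) + (k == c3) = 1)%N.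
  move: k c1 c2 c3 c_uniq.
  by do 4![case=> [[|[|[|[|?]]]] ?] //].
case: eqP => _ /=; first lra.
move=> /(_ isT) /(congr1 (fun n => n%:R : R)); rewrite !natrD; lra.
Qed.

Lemma nat4_ind (P : nat -> Prop) :
  P 0%N -> (forall i k, P i -> P (4 * i + nat_of_ord (k : 'I_4))%N) ->
  forall i, P i.
Proof.
move=> P0 PS; elim/ltn_ind => i IH; have [->//|i_neq0] := eqVneq i 0%N.
have -> : (i = 4 * (i %/ 4) + (inZp i : 'I_4))%N.
  by rewrite /= [(4 * _)%N]mulnC -divn_eq.
by apply: PS; apply: IH; rewrite ltn_Pdiv// lt0n.
Qed.

Lemma bary_itv c (i : nat) : 0 < bary c i < 1.
Proof.
elim/nat4_ind: i => [|i k /andP[b0 b1]]; first by rewrite /bary /=; lra.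
rewrite bary_rec /bary_step; case: ifP => _; first lra.
case: (k == c) => /=; lra.
Qed.

(* Ties between scaled coordinates and integers never occur since the
   centroids have no dyadic coordinates. *)
Lemma bary_non_dyadic c (i k : nat) (z : int) : 2 ^+ k * bary c i != z%:~R.
Proof.
elim/nat4_ind: i k z => [|i d IH] k z.
  rewrite /bary /=; apply/eqP => eq3.
  have : (2 ^ k)%N%:R = (z * 3)%:~R :> R.
    by rewrite intrM -eq3 natrX; lra.
  rewrite pmulrn => /intr_inj eqz.
  have : (3 %| 2 ^ k)%N.
    by apply/dvdnP; exists `|z|%N; lia.
  by rewrite Euclid_dvdX//.
(* Level 0: no integer lies strictly between 0 and 1. Level [k + 1]: the halving in [bary_step]
   cancels one factor 2, leaving level [k]. *)
case: k => [|k].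
  rewrite expr0 mul1r; apply/eqP => wz.
  by have := bary_itv c (4 * i + d); rewrite wz ltr0z ltrz1; lia.
apply/eqP; rewrite bary_rec exprS /bary_step; case: ifP => _ eqz.
  have /eqP := IH k (2 ^+ k - z); apply; rewrite intrB rmorphXn/= -eqz.
  by field.
have /eqP := IH k (z - 2 ^+ k * (d == c)%:R); apply.
rewrite intrB intrM rmorphXn/= -eqz.
by case: (d == c) => /=; field.
Qed.

End Barycentric.

(** * Exact point counts in blocks of [4 ^ k] indices *)

Lemma sumn_base4 (V : nmodType) (f : nat -> V) (n k : nat) :
  \sum_(n * 4 ^ k.+1 <= i < n.+1 * 4 ^ k.+1) f i =
  \sum_(n * 4 ^ k <= i < n.+1 * 4 ^ k) \sum_(d < 4) f (4 * i + d)%N.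
Proof.
rewrite !expnSr !mulnA; move: (n * 4 ^ k)%N (n.+1 * 4 ^ k)%N => x y.
have [xy|yx] := leqP x y; last by rewrite !big_geq ?leq_mul2r ?(ltnW yx).
elim: y xy => [|y IH]; first by rewrite leqn0 => /eqP ->; rewrite !big_geq.
rewrite leq_eqVlt => /orP[/eqP <-|xy]; first by rewrite !big_geq.
rewrite [RHS]big_nat_recr//= -IH// (@big_cat_nat _ _ _ (y * 4))//=; last 2 first.
- by rewrite leq_mul2r.
- by rewrite leq_mul2r leqnSn.
congr (_ + _).
rewrite -{1}[(y * 4)%N]add0n mulSn big_addn addnK big_mkord.
by apply: eq_bigr => d _; rewrite [(4 * y)%N]mulnC addnC.
Qed.

Section Count.
Context (R : realType).
Implicit Types (c : 'I_4).

(** Strips of width [1 / 2 ^ k] parallel to the side opposite vertex [c]: the point lies in one of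
    the first [p], counted from that side. *)
Definition bary_lt c (k p i : nat) : bool := 2 ^+ k * bary c i < p%:R :> R.

Lemma ltr_bary_corner c (i k p : nat) :
  (2 ^+ k.+1 * ((bary c i + 1) / 2) < p%:R :> R) =
  bary_lt c k (p - 2 ^ k) i.
Proof.
rewrite /bary_lt; have /andP[b0 b1] := @bary_itv R c i.
have m_gt0 : 0 < 2 ^+ k :> R by rewrite exprn_gt0.
have mE : (2 ^ k)%N%:R = 2 ^+ k :> R by rewrite natrX.
have [pm|mp] := leqP p (2 ^ k).
  have -> : (p - 2 ^ k = 0)%N by lia.
  have : p%:R <= 2 ^+ k :> R by rewrite -mE ler_nat.
  rewrite exprS => ?; apply/idP/idP=> ?; exfalso; nra.
rewrite natrB ?(ltnW mp)// mE exprS.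
by apply/idP/idP; lra.
Qed.

(** The reflection [w |-> 1 - w] reverses the inequality, and [bary_non_dyadic] makes it strict
    again. If [2 ^ k <= p], the truncated threshold is 0 and both sides are true. *)
Lemma ltr_bary_center c (i k p : nat) :
  (2 ^+ k.+1 * ((1 - bary c i) / 2) < p%:R :> R) =
  ~~ bary_lt c k (2 ^ k - p) i.
Proof.
rewrite /bary_lt; have /andP[b0 b1] := @bary_itv R c i.
have m_gt0 : 0 < 2 ^+ k :> R by rewrite exprn_gt0.
have mE : (2 ^ k)%N%:R = 2 ^+ k :> R by rewrite natrX.
have nd (r : nat) : (r%:R == 2 ^+ k * bary c i) = false.
  by rewrite eq_sym [r%:R]pmulrn; exact/negbTE/bary_non_dyadic.
rewrite -leNgt le_eqVlt nd /=; have [pm|mp] := leqP (2 ^ k) p.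
  have -> : (2 ^ k - p = 0)%N by lia.
  have : 2 ^+ k <= p%:R :> R by rewrite -mE ler_nat.
  by rewrite exprS => ?; apply/idP/idP=> ?; nra.
rewrite natrB ?(ltnW mp)// mE exprS.
by apply/idP/idP; lra.
Qed.

Lemma ltr_bary_side c (i k p : nat) :
  (2 ^+ k.+1 * ((bary c i + 0) / 2) < p%:R :> R) =
  bary_lt c k p i.
Proof. by rewrite /bary_lt exprS addr0; congr (_ < _); field. Qed.

Lemma count_bary (c1 c2 : 'I_4) (n k p q : nat) :
  uniq [:: ord0; c1; c2] ->
  (\sum_(n * 4 ^ k <= i < n.+1 * 4 ^ k)
      (bary_lt c1 k p i && bary_lt c2 k q i))%N%:Z =
  (2 ^ k)%N%:Z ^+ 2 - trunc_sq (2 ^ k) p - trunc_sq (2 ^ k) q +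
    trunc_sq (2 ^ k) (p + q).
Proof.
move=> c_uniq; elim: k p q => [|k IH] p q.
  rewrite expn0 !muln1 big_nat1.
  have bE c (r : nat) : bary_lt c 0 r n = (0 < r)%N.
    rewrite /bary_lt expr0 mul1r; have /andP[b0 b1] := @bary_itv R c n.
    case: r => [|r]; first by apply/negbTE; rewrite -leNgt ltW.
    by rewrite (lt_le_trans b1)// ler1n.
  rewrite !bE /trunc_sq; case: p q => [|p] [|q] //=.
rewrite sumn_base4.
(* The four children of [i]: the central one reverses both tests, the corners [c1] and [c2] each
   lower one threshold by [2 ^ k], the third corner changes neither. *)
have stepE i : (\sum_(d < 4)
    (bary_lt c1 k.+1 p (4 * i + d) &&
     bary_lt c2 k.+1 q (4 * i + d)) =
  ~~ bary_lt c1 k (2 ^ k - p) i &&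
  ~~ bary_lt c2 k (2 ^ k - q) i +
  (bary_lt c1 k (p - 2 ^ k) i &&
   bary_lt c2 k q i) +
  (bary_lt c1 k p i &&
   bary_lt c2 k (q - 2 ^ k) i) +
  (bary_lt c1 k p i && bary_lt c2 k q i))%N.
  rewrite -!ltr_bary_corner -!ltr_bary_center -!ltr_bary_side.
  under eq_bigr do rewrite /bary_lt !bary_rec /bary_step.
  rewrite !big_ord_recl big_ord0.
  move: c1 c2 c_uniq {IH}.
  do 2![case=> [[|[|[|[|?]]]] ?] //] => _; rewrite -!val_eqE /= ?mulr1n ?mulr0n; ring.
rewrite (eq_bigr _ (fun i _ => stepE i)) !big_split /= !PoszD expnS.
pose h x y := (\sum_(n * 4 ^ k <= i < n.+1 * 4 ^ k)
  (bary_lt c1 k x i && bary_lt c2 k y i))%N%:Z.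
apply: (@count_refinement h) => [x y|]; first exact: IH.
rewrite [(2 ^ k)%N%:Z ^+ 2]expr2 -PoszM /h -!PoszD; congr Posz.
(* As the size of the block, this lets the inclusion-exclusion identity be checked index by
   index. *)
have -> : (2 ^ k * 2 ^ k = \sum_(n * 4 ^ k <= i < n.+1 * 4 ^ k) 1)%N.
  by rewrite sum_nat_const_nat muln1 -mulnBl subSnn mul1n -expnMn.
rewrite -!big_split /=; apply: eq_bigr => i _.
have ltm c : bary_lt c k (2 ^ k) i.
  by rewrite /bary_lt natrX gtr_pMr ?exprn_gt0//; have /andP[] := @bary_itv R c i.
by rewrite !ltm; case: bary_lt; case: bary_lt.
Qed.

End Count.

(** * Area of the part of a triangle cut out by bounds on the coordinates *)

Section Area.
Local Open Scope classical_set_scope.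
Local Open Scope ring_scope.
Context {R : realType}.
Implicit Types (x y t k a b c : R).
Local Notation mu := (@lebesgue_measure R).

Lemma max0_cases x : (0 <= x /\ Num.max x 0 = x) \/ (x <= 0 /\ Num.max x 0 = 0).
Proof. by have [x0|x0] := leP x 0; [right|left; split=> //; exact: ltW]. Qed.

(** Squaring smooths the kink of the positive part: the linearization error is at most
    [(z - x) ^ 2], whatever the signs of [x] and [z]. *)
Lemma is_derive_max0_sq x :
  is_derive x (1 : R) (fun z => Num.max z 0 ^+ 2) (2 * Num.max x 0).
Proof.
apply/is_derive1_caratheodory.
exists (fun z => if z == x then 2 * Num.max x 0
  else (Num.max z 0 ^+ 2 - Num.max x 0 ^+ 2) / (z - x)); split.
- move=> z; case: eqP => [->|/eqP zx]; first by rewrite !subrr mulr0.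
  by rewrite divfK// subr_eq0.
- apply/cvgrPdist_le => /= e e0; near=> z; rewrite eqxx.
  case: eqP => [|/eqP zx]; first by rewrite subrr normr0 ltW.
  have zx0 : z - x != 0 by rewrite subr_eq0.
  have -> : 2 * Num.max x 0 - (Num.max z 0 ^+ 2 - Num.max x 0 ^+ 2) / (z - x) =
      (2 * Num.max x 0 * (z - x) - (Num.max z 0 ^+ 2 - Num.max x 0 ^+ 2)) / (z - x).
    by field.
  rewrite normf_div ler_pdivrMr ?normr_gt0//.
  have ze : `|z - x| <= e by rewrite distrC; near: z; exact: cvgr_dist_le.
  apply: (@le_trans _ _ (`|z - x| * `|z - x|)); last first.
    by rewrite ler_wpM2r.
  rewrite -expr2 real_normK ?num_real// ler_norml.
  by have [[? ->]|[? ->]] := max0_cases x; have [[? ->]|[? ->]] := max0_cases z; nra.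
- by rewrite eqxx.
Unshelve. all: by end_near. Qed.

(** At height [y] the third barycentric coordinate is [y / h]; the lengths of horizontal slices are
    combinations of these positive parts. *)
Definition ramp (h k y : R) : R := Num.max (k - y / h) 0.

Lemma is_derive_ramp_sq h k y : h != 0 ->
  is_derive y (1 : R) (fun z => - (h / 2) * ramp h k z ^+ 2) (ramp h k y).
Proof.
move=> h0.
have Dl : is_derive y (1 : R) (fun z => k - z / h) (- h^-1).
  have : is_derive y (1 : R) ((cst k : R -> R) - h^-1 \*: (id : R -> R)) (0 - h^-1 *: 1).
    exact: is_deriveB.
  rewrite sub0r [_ *: _]mulr1; congr is_derive.
  by apply/funext => z; rewrite !fctE /= [_ *: _]mulrC.
have := @is_derive1_comp _ (fun z => Num.max z 0 ^+ 2) (fun z => k - z / h) y _ _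
  (is_derive_max0_sq _) Dl.
move=> /(is_deriveZ (- (h / 2))).
rewrite /ramp => D; apply: is_derive_eq D _.
by rewrite /GRing.scale /=; field.
Qed.

Lemma continuous_ramp h k : continuous (ramp h k).
Proof.
move=> y; have := @continuous_max R R (fun z => k - z / h) (cst 0) y; apply;
  last exact: cst_continuous.
by apply: cvgB; [exact: cvg_cst|apply: cvgM; [exact: cvg_id|exact: cvg_cst]].
Qed.

(* The fraction of the area of a triangle where the barycentric coordinates are
   at most [a], [b] and [c], by inclusion-exclusion: the points where a
   coordinate exceeds [e] form a triangle of ratio [1 - e]. *)
Definition box_fraction a b c : R :=
  1 - Num.max (1 - c) 0 ^+ 2
  - (Num.max (1 - a) 0 ^+ 2 - Num.max (1 - a - c) 0 ^+ 2)
  - (Num.max (1 - b) 0 ^+ 2 - Num.max (1 - b - c) 0 ^+ 2)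
  + (Num.max (1 - a - b) 0 ^+ 2 - Num.max (1 - a - b - c) 0 ^+ 2).

Lemma integral_ramps h a b c : 0 < h -> 0 < c ->
  (\int[mu]_(y in `[0%R, (h * c)%R])
    (ramp h 1 y - ramp h (1 - a) y - ramp h (1 - b) y + ramp h (1 - a - b) y)%:E =
  (h / 2 * box_fraction a b c)%:E)%E.
Proof.
move=> h0 c0.
pose F k z := - (h / 2) * ramp h k z ^+ 2.
pose G := F 1 - F (1 - a) - F (1 - b) + F (1 - a - b).
have dG y : is_derive y (1 : R) G
    (ramp h 1 y - ramp h (1 - a) y - ramp h (1 - b) y + ramp h (1 - a - b) y).
  have dF k := is_derive_ramp_sq h k y (lt0r_neq0 h0).
  exact: is_deriveD.
have cG : continuous G.
  move=> y; apply/differentiable_continuous/derivable1_diffP.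
  by have [] := dG y.
rewrite (@continuous_FTC2 _ _ G).
- rewrite -EFinB; congr EFin.
  rewrite /box_fraction /G /F !fctE /ramp mul0r !subr0.
  have -> : h * c / h = c by field; rewrite gt_eqF.
  rewrite (max_l (ler01 : 0 <= 1)).
  by field.
- by rewrite mulr_gt0.
- apply: continuous_subspaceT => y.
  by apply: cvgD; [apply: cvgB; [apply: cvgB|]|]; exact: continuous_ramp.
- split.
  + by move=> y _; have [] := dG y.
  + exact/cvg_at_right_filter/cG.
  + exact/cvg_at_left_filter/cG.
- by move=> y _; rewrite derive1E; have [] := dG y.
Qed.

(* In the frame (axis1, axis2) the point with barycentric coordinates
   [(1 - s - t, s, t)] is [(u * s + v * t, h * t)]. *)
Definition box (u v h a b c : R) : set (R * R) :=
  [set p | let t := p.2 / h in let s := (p.1 - v * t) / u in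
     [/\ 0 <= 1 - s - t <= a, 0 <= s <= b & 0 <= t <= c]].

Lemma measurable_box u v h a b c : measurable (box u v h a b c).
Proof.
pose t (p : R * R) := p.2 / h; pose s p := (p.1 - v * t p) / u.
have mt : measurable_fun setT t by apply: measurable_funM.
have ms : measurable_fun setT s.
  by apply: measurable_funM => //; apply: measurable_funB => //; apply: measurable_funM.
have mI (f : R * R -> R) x y : measurable_fun setT f ->
    measurable [set p | x <= f p <= y].
  move=> mf; rewrite -[X in measurable X]setTI.
  rewrite (_ : [set p | _] = f @^-1` `[x, y]); first exact: mf.
  by apply/seteqP; split => p /=; rewrite in_itv.
rewrite (_ : box _ _ _ _ _ _ = [set p | 0 <= 1 - s p - t p <= a] `&`
  [set p | 0 <= s p <= b] `&` [set p | 0 <= t p <= c]); last first.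
  by apply/seteqP; split => p /= [] // [].
apply: measurableI; [apply: measurableI|]; apply: mI => //.
by apply: measurable_funB => //; apply: measurable_funB.
Qed.

(** Inclusion-exclusion for the [s] in [[0, x]] with [s <= b] and [x - s <= a]: violating one
    condition, or both, leaves an interval whose length is a positive part. *)
Lemma length_clipped_itv x a b : 0 <= a -> 0 <= b -> 0 <= x ->
  (if Num.max 0 (x - a) < Num.min b x
   then Num.min b x - Num.max 0 (x - a) else 0) =
  Num.max x 0 - Num.max (x - a) 0 - Num.max (x - b) 0 + Num.max (x - a - b) 0.
Proof.
move=> a0 b0 x0; rewrite [Num.max 0 _]maxC (max_l x0).
have [xa|xa] := leP (x - a) 0; have [bx|bx] := leP b x.
- by rewrite (max_l (_ : 0 <= x - b)) ?(max_r (_ : x - a - b <= 0)); case: ltP; lra.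
- by rewrite (max_r (_ : x - b <= 0)) ?(max_r (_ : x - a - b <= 0)); case: ltP; lra.
- rewrite (max_l (_ : 0 <= x - b)); last lra.
  by have [?|?] := leP (x - a - b) 0; case: ltP; lra.
- by rewrite (max_r (_ : x - b <= 0)) ?(max_r (_ : x - a - b <= 0)); case: ltP; lra.
Qed.

Lemma ysection_box u v h a b c y : 0 < u -> 0 < h -> 0 <= a <= 1 -> 0 <= b <= 1 ->
  c <= 1 -> y \in `[0, h * c] ->
  mu (ysection (box u v h a b c) y) =
  (u * (ramp h 1 y - ramp h (1 - a) y - ramp h (1 - b) y + ramp h (1 - a - b) y))%:E.
Proof.
move=> u0 h0 a01 b01 c1; rewrite in_itv /= => /andP[y0 yc].
set t := y / h.
have t0 : 0 <= t by rewrite divr_ge0// ltW.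
have tc : t <= c by rewrite ler_pdivrMr// mulrC.
have -> : ysection (box u v h a b c) y =
    `[u * Num.max 0 (1 - t - a) + v * t, u * Num.min b (1 - t) + v * t]%classic.
  apply/seteqP; split => x; rewrite /ysection /= inE /box /= -/t in_itv /=.
    set s := (x - v * t) / u => -[/andP[w0 wa] /andP[s0 sb] _].
    have -> : x = u * s + v * t by rewrite /s; field; rewrite gt_eqF.
    rewrite !lerD2r !ler_pM2l// ge_max le_min.
    by apply/andP; split; apply/andP; split; lra.
  set s := (x - v * t) / u; have -> : x = u * s + v * t.
    by rewrite /s; field; rewrite gt_eqF.
  rewrite !lerD2r !ler_pM2l// ge_max le_min => /andP[/andP[? ?] /andP[? ?]].
  by split; apply/andP; split => //; lra.
rewrite lebesgue_measure_itv /= lte_fin ltrD2r ltr_pM2l// -EFinB.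
rewrite /ramp -/t [1 - a - t]addrAC [1 - b - t]addrAC.
rewrite [1 - a - b - t]addrAC [1 - a - t]addrAC -length_clipped_itv; [|lra..].
by case: ifP => _; rewrite ?mulr0//; congr EFin; ring.
Qed.

Lemma measure_box u v h a b c : 0 < u -> 0 < h ->
  0 < a <= 1 -> 0 < b <= 1 -> 0 < c <= 1 ->
  ((mu \x mu) (box u v h a b c) = (u * (h / 2 * box_fraction a b c))%:E)%E.
Proof.
move=> u0 h0 /andP[a0 a1] /andP[b0 b1] /andP[c0 c1].
(* Uniqueness of the product measure allows integrating the horizontal slices over the height. *)
have -> : ((mu \x mu) (box u v h a b c) = (mu \x^ mu) (box u v h a b c))%E.
  apply: product_measure_unique => [? ? ? ?|]; last exact: measurable_box.
  exact: product_measure2E.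
rewrite EFinM -integral_ramps//.
rewrite -integralZl//; last first.
  apply: continuous_compact_integrable; first exact: segment_compact.
  apply: continuous_subspaceT => y.
  by apply: cvgD; [apply: cvgB; [apply: cvgB|]|]; exact: continuous_ramp.
rewrite [RHS]integral_mkcond /product_measure2; apply: eq_integral => y _.
rewrite patchE mem_setE; case: ifPn => yc.
  by rewrite /= ysection_box ?EFinM//; lra.
rewrite /= (_ : ysection _ _ = set0) ?measure0//.
apply/seteqP; split => x //; rewrite /ysection /= inE /box /= => -[_ _ /andP[t0 tc]].
move/negP: yc; apply; rewrite in_itv /=; apply/andP; split.
  by move: t0; rewrite pmulr_lge0// invr_gt0.
by move: tc; rewrite ler_pdivrMr// mulrC.
Qed.

End Area.

(** * From exact counts to the discrepancy bound *)

Section Fraction.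
Context {R : realType}.
Implicit Types (m x y a b : R).

(* For [x, y <= m] this is the number of the [m ^ 2] congruent subtriangles of
   side [1 / m] lying in a parallelogram with sides [x / m] and [y / m],
   extended to real [x] and [y]; for [m = 1] it is the fraction of the area of
   a triangle covered by that parallelogram. *)
Definition par_area m x y : R :=
  m ^+ 2 - (m - x) ^+ 2 - (m - y) ^+ 2 + Num.max (m - x - y) 0 ^+ 2.

Lemma par_areaZ m a b : 0 <= m ->
  par_area m (m * a) (m * b) = m ^+ 2 * par_area 1 a b.
Proof.
move=> m_ge0; rewrite /par_area.
have -> : Num.max (m - m * a - m * b) 0 = m * Num.max (1 - a - b) 0.
  by rewrite -[X in Num.max _ X](mulr0 m) maxr_pMr// !mulrBr mulr1.
by ring.
Qed.

(** The derivative in [x] is [2 ((m - x) - (m - x - y)^+)], nonnegative for [x <= m] and [0 <= y];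
    similarly in [y]. *)
Lemma par_areaS m x x' y y' : 0 <= x -> 0 <= y -> x <= x' -> y <= y' ->
  x' <= m -> y' <= m -> par_area m x y <= par_area m x' y'.
Proof.
move=> x0 y0 xx' yy' xm ym; rewrite /par_area.
have [[? ->]|[? ->]] := max0_cases (m - x - y);
have [[? ->]|[? ->]] := max0_cases (m - x' - y'); nra.
Qed.

(** With [z = m - x - y] the increment is [2 m + 2 z - 2 + ((z - 2)^+)^2 - (z^+)^2], where the terms
    after [2 m] have negative sum for every [z]. *)
Lemma par_area_step m x y :
  par_area m (x + 1) (y + 1) - par_area m x y <= 2 * m.
Proof.
rewrite /par_area.
have [[? ->]|[? ->]] := max0_cases (m - x - y);
have [[? ->]|[? ->]] := max0_cases (m - (x + 1) - (y + 1)); nra.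
Qed.

Lemma count_par_area (c1 c2 : 'I_4) (n k p q : nat) :
  uniq [:: ord0; c1; c2] -> (p <= 2 ^ k)%N -> (q <= 2 ^ k)%N ->
  (\sum_(n * 4 ^ k <= i < n.+1 * 4 ^ k)
      (bary_lt R c1 k p i && bary_lt R c2 k q i))%N%:R =
  par_area (2 ^+ k) p%:R q%:R.
Proof.
move=> c_uniq pm qm.
have trE : (trunc_sq (2 ^ k) (p + q))%:~R =
    Num.max (2 ^+ k - p%:R - q%:R) 0 ^+ 2 :> R.
  rewrite -addrA -opprD -natrD -natrX.
  have [pq|/ltnW pq] := leqP (p + q) (2 ^ k).
    by rewrite (trunc_sqE pq) rmorphXn rmorphB/= max_l// subr_ge0 ler_nat.
  by rewrite (trunc_sq_eq0 pq) max_r ?expr0n// subr_le0 ler_nat.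
rewrite [LHS]pmulrn (count_bary R _ _ n k p q c_uniq) (trunc_sqE pm) (trunc_sqE qm).
move: (trunc_sq _ _) trE => t tE.
by rewrite !(rmorphD, rmorphN, rmorphXn) /= tE -!pmulrn natrX.
Qed.

(** Both the count and the scaled area lie between the values of [par_area] at the enclosing grid
    points [(p, q)] and [(p + 1, q + 1)]. *)
Lemma block_discrepancy (c1 c2 : 'I_4) (n k : nat) a b :
  uniq [:: ord0; c1; c2] -> 0 < a <= 1 -> 0 < b <= 1 ->
  `|\sum_(n * 4 ^ k <= i < n.+1 * 4 ^ k)
      (((bary c1 i <= a) && (bary c2 i <= b))%:R - par_area 1 a b)| <= 2 * 2 ^+ k.
Proof.
move=> c_uniq /andP[a0 a1] /andP[b0 b1].
have m0 : 0 < 2 ^+ k :> R by rewrite exprn_gt0.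
(* Ceiling minus one rather than floor, so that [p + 1 <= 2 ^ k] even for [x = 1] and the exact
   count applies at both grid points. *)
have itvP x : 0 < x <= 1 ->
    exists2 p : nat, p%:R < 2 ^+ k * x <= p%:R + 1 & (p < 2 ^ k)%N.
  move=> /andP[x0 x1]; have mx0 : 0 < 2 ^+ k * x by rewrite mulr_gt0.
  have := ceil_itv (2 ^+ k * x); have : 0 < Num.ceil (2 ^+ k * x) by rewrite ceil_gt0.
  case: (Num.ceil _) => [[//|p]|//] _; rewrite -[p.+1]addn1 PoszD addrK intrD.
  rewrite -!pmulrn => pE; exists p => //; case/andP: pE => pE _.
  by rewrite -(ltr_nat R) natrX (lt_le_trans pE)// ger_pMr.
have [|p pE pm] := itvP a; first lra.
have [|q qE qm] := itvP b; first lra.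
rewrite sumrB sumr_const_nat -mulnBl subSnn mul1n.
have -> : par_area 1 a b *+ 4 ^ k = par_area (2 ^+ k) (2 ^+ k * a) (2 ^+ k * b).
  rewrite par_areaZ ?(ltW m0)// -[LHS]mulr_natl; congr (_ * _).
  by rewrite -exprM mulnC exprM expr2 -natrM natrX.
rewrite -natr_sum.
have lo : par_area (2 ^+ k) p%:R q%:R <= (\sum_(n * 4 ^ k <= i < n.+1 * 4 ^ k)
    ((bary c1 i <= a)%R && (bary c2 i <= b)%R))%N%:R.
  rewrite -(count_par_area _ _ n _ _ _ c_uniq (ltnW pm) (ltnW qm)) ler_nat.
  apply: leq_sum => i _.
  have imp c r x : r%:R < 2 ^+ k * x -> bary_lt R c k r i -> bary c i <= x.
    by rewrite /bary_lt => h1 h2; rewrite -(ler_pM2l m0) ltW// (lt_trans h2).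
  case: (boolP (bary_lt R c1 k p i)) => // /imp -> /=; last by case/andP: pE.
  by case: (boolP (bary_lt R c2 k q i)) => // /imp -> //; case/andP: qE.
have hi : (\sum_(n * 4 ^ k <= i < n.+1 * 4 ^ k)
    ((bary c1 i <= a)%R && (bary c2 i <= b)%R))%N%:R
    <= par_area (2 ^+ k) (p%:R + 1) (q%:R + 1).
  rewrite !natr1 -(count_par_area _ _ n _ _ _ c_uniq pm qm) ler_nat.
  apply: leq_sum => i _.
  have imp c r x : 2 ^+ k * x <= r%:R + 1 -> bary c i <= x -> bary_lt R c k r.+1 i.
    rewrite natr1 /bary_lt => h1 h2; rewrite lt_neqAle [r.+1%:R]pmulrn bary_non_dyadic /=.
    by rewrite (le_trans _ h1)// ler_pM2l.
  case: (boolP (bary c1 i <= a)) => // /imp -> /=; last by case/andP: pE.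
  by case: (boolP (bary c2 i <= b)) => // /imp -> //; case/andP: qE.
have lo' : par_area (2 ^+ k) p%:R q%:R <=
    par_area (2 ^+ k) (2 ^+ k * a) (2 ^+ k * b).
  by apply: par_areaS => //; rewrite ?ger_pMr//; lra.
have hi' : par_area (2 ^+ k) (2 ^+ k * a) (2 ^+ k * b) <=
    par_area (2 ^+ k) (p%:R + 1) (q%:R + 1).
  have le_m (r : nat) : (r < 2 ^ k)%N -> r%:R + 1 <= 2 ^+ k :> R.
    by move=> ?; rewrite natr1 -natrX ler_nat.
  by apply: par_areaS; rewrite ?mulr_ge0 ?le_m//; lra.
have := par_area_step (2 ^+ k) p%:R q%:R.
by rewrite ler_norml; lra.
Qed.

(** The range starts at [N] with its [k] lowest base-4 digits cleared. Digit [j] contributes at most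
    three blocks, each at most [2 * 2 ^ j], and the geometric sum gives the bound. *)
Lemma initial_discrepancy (c1 c2 : 'I_4) (N k : nat) a b :
  uniq [:: ord0; c1; c2] -> 0 < a <= 1 -> 0 < b <= 1 ->
  `|\sum_(N %/ 4 ^ k * 4 ^ k <= i < N)
      (((bary c1 i <= a) && (bary c2 i <= b))%:R - par_area 1 a b)|
    <= 6 * (2 ^+ k - 1).
Proof.
move=> c_uniq a01 b01.
pose D i := ((bary c1 i <= a) && (bary c2 i <= b))%:R - par_area 1 a b.
rewrite -[X in `|X|]/(\sum_(N %/ 4 ^ k * 4 ^ k <= i < N) D i).
elim: k => [|k IH].
  by rewrite expn0 divn1 muln1 big_geq// normr0 expr0 subrr mulr0.
set q := (N %/ 4 ^ k.+1)%N.
have NE : (N %/ 4 ^ k = q * 4 + (N %/ 4 ^ k) %% 4)%N.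
  by rewrite /q expnSr divnMA -divn_eq.
have qE : (q * 4 ^ k.+1 = q * 4 * 4 ^ k)%N by rewrite expnS mulnA.
have le1 : (q * 4 * 4 ^ k <= N %/ 4 ^ k * 4 ^ k)%N.
  by rewrite leq_mul2r NE leq_addr orbT.
rewrite qE (@big_cat_nat _ _ _ (N %/ 4 ^ k * 4 ^ k))//=; last exact: leq_trunc_div.
apply: le_trans (ler_normD _ _) _.
have : forall r, (r <= 3)%N ->
    `|\sum_(q * 4 * 4 ^ k <= i < (q * 4 + r) * 4 ^ k) D i| <= r%:R * (2 * 2 ^+ k).
  elim=> [|r IHr] r3; first by rewrite addn0 big_geq// normr0 mul0r.
  rewrite addnS (@big_cat_nat _ _ _ ((q * 4 + r) * 4 ^ k))//=; last 2 first.
  - by rewrite leq_mul2r leq_addr orbT.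
  - by rewrite leq_mul2r leqnSn orbT.
  apply: le_trans (ler_normD _ _) _.
  rewrite -natr1 mulrDl mul1r lerD//; first by rewrite IHr// ltnW.
  exact: block_discrepancy.
move=> /(_ ((N %/ 4 ^ k) %% 4)%N); rewrite -NE -ltnS ltn_pmod// => /(_ isT) le2.
have rle : ((N %/ 4 ^ k) %% 4)%:R <= 3 :> R.
  by rewrite ler_nat -ltnS ltn_pmod.
have m0 : 0 < 2 ^+ k :> R by rewrite exprn_gt0.
rewrite exprS; move: IH le2; nra.
Qed.

Lemma vdc_box_discrepancy (c1 c2 : 'I_4) (N : nat) a b :
  uniq [:: ord0; c1; c2] -> 0 < a <= 1 -> 0 < b <= 1 -> (0 < N)%N ->
  `|par_area 1 a b -
    (\sum_(i < N) ((bary c1 i <= a) && (bary c2 i <= b))%:R) / N%:R|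
    <= 12 / Num.sqrt N%:R.
Proof.
move=> c_uniq a01 b01 N_gt0.
have N0 : 0 < N%:R :> R by rewrite ltr0n.
have sN0 : 0 < Num.sqrt N%:R :> R by rewrite sqrtr_gt0.
have sNE : Num.sqrt N%:R ^+ 2 = N%:R :> R by rewrite sqr_sqrtr ?ler0n.
(* This exponent clears every digit of [N], so the range starts at 0. *)
have := @initial_discrepancy c1 c2 N (trunc_log 4 N).+1 a b c_uniq a01 b01.
rewrite divn_small ?trunc_log_ltn// mul0n big_mkord sumrB.
rewrite sumr_const card_ord; set S := \sum_(i < N) _ => SE.
have -> : par_area 1 a b - S / N%:R = - ((S - par_area 1 a b *+ N) / N%:R).
  by rewrite -mulr_natr; field; rewrite gt_eqF.
rewrite normrN normf_div (ger0_norm (ltW N0)) ler_pdivrMr//.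
rewrite -[X in _ <= _ * X]sNE.
have -> : 12 / Num.sqrt N%:R * Num.sqrt N%:R ^+ 2 = 12 * Num.sqrt N%:R :> R.
  by field; rewrite gt_eqF.
have : 2 ^+ trunc_log 4 N <= Num.sqrt N%:R :> R.
  rewrite -(@ler_pXn2r _ 2)// ?nnegrE ?exprn_ge0 ?sqrtr_ge0// sNE -exprM mulnC.
  by rewrite exprM -!natrX ler_nat trunc_logP.
by move: SE; rewrite exprS; lra.
Qed.

(** The suffix names the vertex of the parallelogram: its own coordinate has the vacuous bound 1. *)
Lemma box_fractionA b c : 0 < b <= 1 -> 0 < c <= 1 ->
  box_fraction 1 b c = par_area 1 b c.
Proof.
move=> /andP[b0 b1] /andP[c0 c1]; rewrite /box_fraction /par_area subrr maxxx.
rewrite (max_l (_ : 0 <= 1 - b)) ?(max_l (_ : 0 <= 1 - c)); [|lra..].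
rewrite !(max_r (_ : 0 - _ <= 0)) ?(max_r (_ : 0 - _ - _ <= 0)); [|lra..].
by ring.
Qed.

Lemma box_fractionB a c : 0 < a <= 1 -> 0 < c <= 1 ->
  box_fraction a 1 c = par_area 1 a c.
Proof.
move=> a01 c01; rewrite -box_fractionA// /box_fraction.
rewrite [1 - a - 1]addrAC; ring.
Qed.

Lemma box_fractionC a b : 0 < a <= 1 -> 0 < b <= 1 ->
  box_fraction a b 1 = par_area 1 a b.
Proof.
move=> a01 b01; rewrite -box_fractionA// /box_fraction.
rewrite [1 - a - 1]addrAC [1 - b - 1]addrAC [1 - a - b - 1]addrAC.
by rewrite [1 - a - 1]addrAC; ring.
Qed.

End Fraction.

(** * Triangles, parallelograms and points in barycentric coordinates *)

Section Geometry.
Context {R : realType} {d : nat}.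
Local Open Scope classical_set_scope.
Local Open Scope ring_scope.
Implicit Types (A B C x : 'rV[R]_d) (a b c s t : R).
Local Notation mu := (@lebesgue_measure R).

Let iA : 'I_4 := @Ordinal 4 1 isT.
Let iB : 'I_4 := @Ordinal 4 2 isT.
Let iC : 'I_4 := @Ordinal 4 3 isT.

Lemma centroid_subtri_seq A B C (ks : seq 'I_4) :
  centroid (subtri_seq (Triangle A B C) ks) =
  bary_word iA ks *: A + bary_word iB ks *: B + bary_word iC ks *: C.
Proof.
elim: ks A B C => [|k ks IH] A B C /=.
  by rewrite /centroid /= !scalerDr.
(* The central subtriangle gives coefficients like [(v + w) / 2], equal to [(1 - u) / 2] because the
   coordinates sum to 1. *)
have := @sum_bary_word R iA iB iC ks isT.
case: k => [[|[|[|[|?]]]] ?] //=; rewrite IH /bary_step -!val_eqE /=;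
  move: (bary_word iA ks) (bary_word iB ks) (bary_word iC ks) => u v w uvw;
  (have -> : u = 1 - v - w by lra);
  by apply/rowP => j; rewrite !mxE /=; field.
Qed.

Definition tri_point A B C s t : 'rV[R]_d := A + s *: (B - A) + t *: (C - A).

Lemma vdcE A B C (i : nat) :
  vdc (Triangle A B C) i = tri_point A B C (bary iB i) (bary iC i).
Proof.
rewrite /vdc centroid_subtri_seq /tri_point /bary.
have := @sum_bary_word R iA iB iC (digits4 i) isT.
move: (bary_word iA _) (bary_word iB _) (bary_word iC _) => u v w uvw.
have -> : u = 1 - v - w by lra.
by apply/rowP => j; rewrite !mxE; ring.
Qed.

Lemma tri_point_inj {A B C s t s' t'} : ~ collinear A B C ->
  tri_point A B C s t = tri_point A B C s' t' -> s = s' /\ t = t'.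
Proof.
move=> nABC E.
have E0 : (s - s') *: (B - A) + (t - t') *: (C - A) = 0.
  have /eqP := E; rewrite -subr_eq0 => /eqP <-; rewrite /tri_point.
  by apply/rowP => j; rewrite !mxE; ring.
have tt' : t = t'.
  apply/eqP; rewrite -subr_eq0; apply: contra_notT nABC => t0.
  exists A, (B - A), 0, 1, (- (s - s') / (t - t')).
  split; [by rewrite scale0r addr0|by rewrite scale1r subrKC|].
  have -> : (- (s - s') / (t - t')) *: (B - A) = C - A.
    by apply: (scalerI t0); rewrite -(addr0_eq E0) scalerA mulrC divfK// scaleNr.
  by rewrite subrKC.
split=> //; apply/eqP; rewrite -subr_eq0; apply: contra_notT nABC => s0.
move: E0; rewrite tt' subrr scale0r addr0 => /eqP.
rewrite scaler_eq0 (negPf s0) /= => /eqP BA.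
exists A, (C - A), 0, 0, 1; split; rewrite ?scale0r ?addr0 ?scale1r ?subrKC//.
exact: subr0_eq.
Qed.

Definition tri_box A B C a b c : set 'rV[R]_d :=
  [set x | exists s t, [/\ x = tri_point A B C s t,
     0 <= 1 - s - t <= a, 0 <= s <= b & 0 <= t <= c]].

Lemma tri_point_box {A B C a b c s t} : ~ collinear A B C ->
  tri_box A B C a b c (tri_point A B C s t) <->
  [/\ 0 <= 1 - s - t <= a, 0 <= s <= b & 0 <= t <= c].
Proof.
move=> nABC; split; last by move=> [? ? ?]; exists s, t.
by move=> [s' [t' [/(tri_point_inj nABC)[-> ->]]]].
Qed.

Lemma tri_setE A B C : tri_set (Triangle A B C) = tri_box A B C 1 1 1.
Proof.
apply/seteqP; split => x.
  move=> [w1 [w2 [w3 [w10 w20 w30 ws ->]]]]; exists w2, w3; split; last 3 first.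
  - by apply/andP; split; lra.
  - by apply/andP; split; lra.
  - by apply/andP; split; lra.
  have -> : w1 = 1 - w2 - w3 by lra.
  by apply/rowP => j; rewrite !mxE /=; ring.
move=> [s [t [-> /andP[? ?] /andP[? ?] /andP[? ?]]]].
exists (1 - s - t), s, t; split => //; first by ring.
by apply/rowP => j; rewrite !mxE /=; ring.
Qed.

Lemma parallelogramA {A B C b c} : ~ collinear A B C -> b <= 1 -> c <= 1 ->
  parallelogram A B C b c `&` tri_set (Triangle A B C) = tri_box A B C 1 b c.
Proof.
move=> nABC b1 c1; rewrite tri_setE; apply/seteqP; split => x.
  move=> [[s [t [hs ht ->]]]]; rewrite -/(tri_point A B C s t).
  by move=> /(tri_point_box nABC)[? ? ?]; exists s, t.
move=> [s [t [-> ? /andP[s0 sb] /andP[t0 tc]]]]; split.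
  by exists s, t; rewrite s0 t0 sb tc.
by exists s, t; rewrite s0 t0 (le_trans sb) ?(le_trans tc).
Qed.

Lemma parallelogramB {A B C a c} : ~ collinear A B C -> a <= 1 -> c <= 1 ->
  parallelogram B A C a c `&` tri_set (Triangle A B C) = tri_box A B C a 1 c.
Proof.
move=> nABC a1 c1; rewrite tri_setE.
have BE s t : B + s *: (A - B) + t *: (C - B) = tri_point A B C (1 - s - t) t.
  by apply/rowP => j; rewrite !mxE /=; ring.
apply/seteqP; split => x.
  move=> [[s [t [hs ht ->]]]]; rewrite BE.
  move=> /(tri_point_box nABC)[? ? ?]; exists (1 - s - t), t.
  by split=> //; rewrite (_ : 1 - (1 - s - t) - t = s)//; ring.
move=> [s [t [-> /andP[w0 wa] /andP[s0 s1] /andP[t0 tc]]]]; split.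
  exists (1 - s - t), t; rewrite w0 wa t0 tc BE; split=> //.
  by congr tri_point; ring.
by exists s, t; rewrite s0 s1 t0 w0 (le_trans wa) ?(le_trans tc).
Qed.

Lemma parallelogramC {A B C a b} : ~ collinear A B C -> a <= 1 -> b <= 1 ->
  parallelogram C A B a b `&` tri_set (Triangle A B C) = tri_box A B C a b 1.
Proof.
move=> nABC a1 b1; rewrite tri_setE.
have CE s t : C + s *: (A - C) + t *: (B - C) = tri_point A B C t (1 - s - t).
  by apply/rowP => j; rewrite !mxE /=; ring.
apply/seteqP; split => x.
  move=> [[s [t [hs ht ->]]]]; rewrite CE.
  move=> /(tri_point_box nABC)[? ? ?]; exists t, (1 - s - t).
  by split=> //; rewrite (_ : 1 - t - (1 - s - t) = s)//; ring.
move=> [s [t [-> /andP[w0 wa] /andP[s0 sb] /andP[t0 t1]]]]; split.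
  exists (1 - s - t), s; rewrite w0 wa s0 sb CE; split=> //.
  by congr tri_point; ring.
by exists s, t; rewrite s0 t1 t0 w0 (le_trans wa) ?(le_trans sb).
Qed.

Lemma unit_vecK {u : 'rV[R]_d} : u != 0 ->
  exists2 r : R, 0 < r & u = r *: unit_vec u.
Proof.
move=> u0; have r0 : 0 < Num.sqrt (dot u u) by rewrite sqrtr_gt0 dot_gt0.
exists (Num.sqrt (dot u u)) => //.
by rewrite /unit_vec scalerA mulfV ?gt_eqF// scale1r.
Qed.

(** [u] is the length of the side AB, [h] the height of C over it and [v] the abscissa of the foot
    of that height. *)
Lemma frameE {A B C} (T := Triangle A B C) : ~ collinear A B C ->
  exists u v h : R, [/\ 0 < u, 0 < h, B - A = u *: axis1 T &
    C - A = v *: axis1 T + h *: axis2 T].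
Proof.
move=> nABC.
have AB : B - A != 0.
  apply: contra_notN nABC => /eqP/subr0_eq ->.
  by exists A, (C - A), 0, 0, 1; rewrite scale0r addr0 scale1r subrKC.
have [u u0 uE] := unit_vecK AB.
set v := dot (C - A) (axis1 T).
have AC : C - A - v *: axis1 T != 0.
  apply: contra_notN nABC => /eqP/subr0_eq CA.
  exists A, (axis1 T), 0, u, v.
  by rewrite scale0r addr0 -[u *: _]uE -CA !subrKC.
have [h h0 hE] := unit_vecK AC.
by exists u, v, h; split => //; rewrite -[h *: _]hE subrKC.
Qed.

Lemma vol_tri_box A B C : ~ collinear A B C ->
  exists2 r : R, 0 < r & forall a b c, 0 < a <= 1 -> 0 < b <= 1 -> 0 < c <= 1 ->
  vol (Triangle A B C) (tri_box A B C a b c) =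
  (r * box_fraction a b c)%:E.
Proof.
move=> nABC; have [u [v [h [u0 h0 BA CA]]]] := frameE nABC.
(* Half base times height, the area of the triangle. *)
exists (u * (h / 2)); first by rewrite mulr_gt0// divr_gt0.
move=> a b c a01 b01 c01; rewrite -mulrA -(measure_box _ v)//.
rewrite /vol /=; congr ((mu \x mu)%E _).
have pE (p : R * R) :
    A + p.1 *: axis1 (Triangle A B C) + p.2 *: axis2 (Triangle A B C) =
    tri_point A B C ((p.1 - v * (p.2 / h)) / u) (p.2 / h).
  rewrite /tri_point BA CA; move: (axis1 _) (axis2 _) => e1 e2.
  by apply/rowP => j; rewrite !mxE; field; rewrite !gt_eqF.
apply/seteqP; split => p /=; rewrite pE.
  by move/(tri_point_box nABC).
by move=> [? ? ?]; apply/(tri_point_box nABC).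
Qed.

Lemma tri_box_fraction A B C a b c : ~ collinear A B C ->
  0 < a <= 1 -> 0 < b <= 1 -> 0 < c <= 1 ->
  fine (vol (Triangle A B C) (tri_box A B C a b c)) /
    fine (vol (Triangle A B C) (tri_set (Triangle A B C))) =
  box_fraction a b c.
Proof.
move=> nABC a01 b01 c01; have [r r0 rE] := vol_tri_box _ _ _ nABC.
have one01 : 0 < (1 : R) <= (1 : R) by rewrite ltr01 lexx.
rewrite tri_setE !rE//= (_ : box_fraction 1 1 1 = 1).
  by rewrite mulr1 mulrAC mulfV ?mul1r// gt_eqF.
by rewrite /box_fraction subrr maxxx !(max_r (_ : _ <= 0)) ?expr0n/=; lra.
Qed.

Lemma bary_vdc_box {A B C a b c} {i : nat} : ~ collinear A B C ->
  tri_box A B C a b c (vdc (Triangle A B C) i) <->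
  [&& bary iA i <= a, bary iB i <= b & bary iC i <= c].
Proof.
move=> nABC; rewrite vdcE tri_point_box//.
have sumE : bary iA i + bary iB i + bary iC i = 1 :> R by exact: sum_bary_word.
have -> : 1 - bary iB i - bary iC i = bary iA i :> R by lra.
have /andP[/ltW -> _] := @bary_itv R iA i.
have /andP[/ltW -> _] := @bary_itv R iB i.
have /andP[/ltW -> _] := @bary_itv R iC i.
by rewrite /=; split=> [[-> -> ->]//|/and3P[]].
Qed.

Lemma delta_tri_box {A B C} {S : set 'rV[R]_d} (N : nat) {a b c} :
  ~ collinear A B C -> S `&` tri_set (Triangle A B C) = tri_box A B C a b c ->
  0 < a <= 1 -> 0 < b <= 1 -> 0 < c <= 1 ->
  delta S (mkseq (vdc (Triangle A B C)) N) (Triangle A B C) =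
  box_fraction a b c - (\sum_(i < N)
    [&& bary iA i <= a, bary iB i <= b & bary iC i <= c]%:R) / N%:R.
Proof.
move=> nABC SE a01 b01 c01.
rewrite /delta SE tri_box_fraction// size_mkseq; congr (_ - _ / _).
rewrite big_map -{1}[N]subn0 big_mkord; apply: eq_bigr => i _.
rewrite indicE; congr (nat_of_bool _)%:R; apply/idP/idP.
  rewrite inE => Sx; apply/(bary_vdc_box nABC); rewrite -SE; split=> //.
  (* The points lie in the triangle, so membership in [S] and in its trace on the triangle agree. *)
  rewrite tri_setE; apply/(bary_vdc_box nABC).
  have le1 e : bary e i <= 1 :> R by case/andP: (@bary_itv R e i) => _ /ltW.
  by rewrite !le1.
by move=> /(bary_vdc_box nABC); rewrite -SE inE => -[].
Qed.

End Geometry.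

Theorem theorem4 (R : realType) (d : nat) (A B C : 'rV[R]_d) (N : nat)
    (hABC : ~ collinear A B C) (hN : (1 <= N)%N) :
  (par_discrepancy (mkseq (vdc (Triangle A B C)) N) (Triangle A B C)
     <= (12 / Num.sqrt N%:R)%:E)%E.
Proof.
have one01 : 0 < (1 : R) <= (1 : R) by rewrite ltr01 lexx.
(* Discharges the test on the coordinate of the parallelogram's own vertex. *)
have le1 e i : (bary e i <= 1 :> R) = true.
  by case/andP: (@bary_itv R e i) => _ /ltW.
apply: ub_ereal_sup => _ [S [[]|] [a + [b + <-]] <-]; rewrite /= !in_itv /=;
  move=> a01 b01; rewrite lee_fin; case/andP: (a01) (b01) => _ a1 /andP[_ b1].
- rewrite (delta_tri_box N hABC (parallelogramA hABC a1 b1))//.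
  rewrite box_fractionA//.
  under eq_bigr do rewrite le1/=.
  exact: vdc_box_discrepancy.
- rewrite (delta_tri_box N hABC (parallelogramB hABC a1 b1))// box_fractionB//.
  under eq_bigr do rewrite le1/=.
  exact: vdc_box_discrepancy.
- rewrite (delta_tri_box N hABC (parallelogramC hABC a1 b1))// box_fractionC//.
  under eq_bigr do rewrite le1 andbT.
  exact: vdc_box_discrepancy.
Qed.
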